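(* Let $n\ge 2$ and $m=3^{n-1}$. Let $H=C_3\times P_{m}$ be the cylinder with vertex set $\{0,1,2\}\times\{1,\dots,m\}$, where $(a,r)\sim(a',r)$ for $a\ne a'$ and $(a,r)\sim(a,r+1)$. Let $lex:V(Q_n^3)\to V(H)$ send the vertex $(x_{n-1},\dots,x_0)$ of $Q_n^3$, with integer label $N=\sum_i x_i3^i=3(r-1)+a$ ($a\in\{0,1,2\}$, $1\le r\le m$), to $(a,r)$, and route each edge $(u,v)$ of $Q_n^3$ along a shortest path between $lex(u)$ and $lex(v)$ in $H$. Then $WL_{lex}(Q_n^3,H)=WL(Q_n^3,H)$, i.e. this embedding has minimum wirelength.
   Context: $Q_n^3$ is the graph on $\{0,1,2\}^n$ in which two tuples are adjacent iff they differ in exactly one coordinate $j$ and there $x_j\equiv y_j\pm 1\pmod 3$. An embedding of a graph $G$ into a graph $H$ with $|V(G)|=|V(H)|$ is a bijection $f:V(G)\to V(H)$ together with, for every edge $(u,v)$ of $G$, a path $P_f(u,v)$ in $H$ joining $f(u)$ and $f(v)$. For $e\in E(H)$, the congestion $c_f(e)$ is the number of edges $(u,v)$ of $G$ with $e\in P_f(u,v)$; the wirelength is $WL_f(G,H)=\sum_{e\in E(H)}c_f(e)$, and $WL(G,H)$ is the minimum of $WL_f(G,H)$ over all embeddings $f$. *)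

(* Defs.v *)
From HB Require Import structures.
From mathcomp Require Import all_boot.

Set Implicit Arguments.
Unset Strict Implicit.
Unset Printing Implicit Defensive.

Record sgraph := SGraph {
  vertex :> finType;
  adj : rel vertex;
  adj_sym : symmetric adj;
  adj_irr : irreflexive adj }.

Definition edges (G : sgraph) : {set {set G}} :=
  [set e : {set G} | [exists x : G, exists y : G, adj x y && (e == [set x; y])]].

(* A nonempty list of vertices, read as a simple path; the end points are
   unordered, since the routed edges of the guest graph are undirected. *)
Definition joins (H : sgraph) (x y : H) (p : seq H) : bool :=
  if p is z :: s then
    [&& path (@adj H) z s, uniq (z :: s) & [set z; last z s] == [set x; y]]
  else false.

Definition path_edges (H : sgraph) (p : seq H) : seq {set H} :=
  if p is z :: s then pairmap (fun u v => [set u; v]) z s else [::].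

(* [route] only matters on the edges of G. *)
Record embedding (G H : sgraph) := Embedding {
  emb :> G -> H;
  emb_bij : bijective emb;
  route : {set G} -> seq H;
  routeP : forall u v : G,
    adj u v -> joins (emb u) (emb v) (route [set u; v]) }.

Definition congestion (G H : sgraph) (f : embedding G H) (e : {set H}) : nat :=
  #|[set d in edges G | e \in path_edges (route f d)]|.

Definition wirelength (G H : sgraph) (f : embedding G H) : nat :=
  \sum_(e in edges H) congestion f e.

(* WL(G, H) = w *)
Definition is_min_wirelength (G H : sgraph) (w : nat) : Prop :=
  (exists f : embedding G H, wirelength f = w) /\
  (forall f : embedding G H, w <= wirelength f).

Definition shortest_routed (G H : sgraph) (f : embedding G H) : Prop :=
  forall u v : G, adj u v ->
  forall q : seq H, joins (f u) (f v) q -> size (route f [set u; v]) <= size q.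

(* The second disjunct is x_j = y_j - 1 mod 3, written without subtraction. *)
Definition qadj (n : nat) : rel {ffun 'I_n -> 'I_3} := fun x y =>
  [exists j : 'I_n,
     ((x j == y j + 1 %[mod 3]) || (x j + 1 == y j %[mod 3])) &&
     [forall i : 'I_n, (i != j) ==> (x i == y i)]].

Lemma qadj_sym n : symmetric (@qadj n).
Proof.
move=> x y; apply: eq_existsb => j; congr (_ && _).
  by rewrite orbC eq_sym [X in _ || X]eq_sym.
by apply: eq_forallb => i; rewrite eq_sym [x i == _]eq_sym.
Qed.

Lemma qadj_irr n : irreflexive (@qadj n).
Proof.
move=> x; apply/existsP => -[j /andP[]].
by case: (x j) => -[|[|[|]]].
Qed.

Definition Q3 (n : nat) : sgraph := SGraph (@qadj_sym n) (@qadj_irr n).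

(* The row r in {1, ..., m} is represented by r - 1 : 'I_m. *)
Definition cyl_adj (m : nat) : rel ('I_3 * 'I_m) := fun x y =>
  ((x.1 != y.1) && (x.2 == y.2)) ||
  ((x.1 == y.1) && ((x.2.+1 == y.2 :> nat) || (y.2.+1 == x.2 :> nat))).

Lemma cyl_adj_sym m : symmetric (@cyl_adj m).
Proof.
move=> x y; rewrite /cyl_adj (eq_sym x.1) (eq_sym x.2).
by congr (_ || (_ && _)); rewrite orbC.
Qed.

Lemma cyl_adj_irr m : irreflexive (@cyl_adj m).
Proof. by move=> x; rewrite /cyl_adj !eqxx /= orbb gtn_eqF. Qed.

Definition cylinder (m : nat) : sgraph :=
  SGraph (@cyl_adj_sym m) (@cyl_adj_irr m).

Definition label (n : nat) (x : 'I_n -> 'I_3) : nat := \sum_(i < n) x i * 3 ^ i.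

Lemma labelS n (x : 'I_n.+1 -> 'I_3) :
  label x = label (fun i => x (lift ord0 i)) * 3 + x ord0.
Proof.
rewrite /label big_ord_recl muln1 addnC big_distrl /=; congr (_ + _).
by apply: eq_bigr => i _; rewrite /bump /= add1n expnSr mulnA.
Qed.

Lemma label_row n (x : 'I_n -> 'I_3) : label x %/ 3 < 3 ^ n.-1.
Proof.
case: n x => [|n] x; first by rewrite /label big_ord0.
rewrite ltn_divLR //= -expnSr; elim: n.+1 x => {n} [|n IHn] x.
  by rewrite /label big_ord0.
rewrite labelS expnSr -ltn_divLR // divnMDl // divn_small ?ltn_ord // addn0.
exact: IHn.
Qed.

Definition lex (n : nat) (x : Q3 n) : cylinder (3 ^ n.-1) :=
  (Ordinal (ltn_pmod (label x) (isT : 0 < 3)), Ordinal (label_row x)).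

Lemma lexP n (x : Q3 n) : label x = 3 * (lex x).2 + (lex x).1.
Proof. by rewrite mulnC; exact: divn_eq. Qed.

Lemma label_inj n (x y : 'I_n -> 'I_3) : label x = label y -> x =1 y.
Proof.
elim: n x y => [|n IHn] x y; first by move=> _ [].
rewrite !labelS => E.
have E0 : x ord0 = y ord0.
  move: (congr1 (modn^~ 3) E); rewrite !modnMDl !modn_small ?ltn_ord //.
  exact: val_inj.
move: E; rewrite E0 => /addIn/eqP; rewrite eqn_pmul2r // => /eqP/IHn E i.
by case: (unliftP ord0 i) => [j|] ->.
Qed.

Lemma lex_bij n : 0 < n -> bijective (@lex n).
Proof.
move=> n_gt0; apply: inj_card_bij.
  move=> x y E; apply/ffunP; apply: label_inj.
  by rewrite (lexP x) (lexP y) E.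
by rewrite /= card_prod card_ffun !card_ord -expnS prednK.
Qed.

Lemma cylinder_joins m (x y : cylinder m) : exists p, joins x y p.
Proof.
have sc : connect_sym (@adj (cylinder m)).
  by apply: sym_connect_sym; exact: adj_sym.
have down (a : 'I_3) (r s : 'I_m) : r <= s ->
    connect (@adj (cylinder m)) (a, r) (a, s).
  case: s => s; elim: s => [|s IHs] lts /=.
    by rewrite leqn0 => /eqP r0; rewrite (_ : r = Ordinal lts) //; exact: val_inj.
  rewrite leq_eqVlt => /predU1P[rE|].
    by rewrite (_ : r = Ordinal lts) //; exact: val_inj.
  rewrite ltnS => les; apply: connect_trans (IHs (ltnW lts) les) _.
  by apply: connect1; rewrite /= /cyl_adj /= !eqxx.
have : connect (@adj (cylinder m)) x y.
  case: x y => [a r] [b s].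
  apply: (@connect_trans _ _ (b, r)).
    have [->|ab] := eqVneq a b; first exact: connect0.
    by apply: connect1; rewrite /= /cyl_adj /= ab eqxx.
  by have [/down //|/ltnW/down] := leqP r s; rewrite sc.
case/connectP => p /shortenP[q pq uq _] ->.
by exists (x :: q); rewrite /= pq eqxx andbT; exact: uq.
Qed.

(* The embeddings considered in the main statement do exist. *)
Lemma lex_embedding_exists n : 0 < n ->
  exists f : embedding (Q3 n) (cylinder (3 ^ n.-1)),
    (forall x, f x = lex x) /\ shortest_routed f.
Proof.
move=> n_gt0; set H := cylinder _.
have short (x y : H) : exists p, joins x y p /\
    forall q, joins x y q -> size p <= size q.
  have exk : exists k, [exists t : k.-tuple H, joins x y t].
    have [p xyp] := cylinder_joins x y.
    by exists (size p); apply/existsP; exists (in_tuple p).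
  case: (ex_minnP exk) => k /existsP[t xyt] mink.
  exists t; split=> // q xyq; rewrite size_tuple; apply: mink.
  by apply/existsP; exists (in_tuple q).
have /fin_all_exists[rt rtP] (d : {set Q3 n}) : exists p : seq H,
    forall u v : Q3 n, d = [set u; v] -> joins (lex u) (lex v) p /\
      forall q, joins (lex u) (lex v) q -> size p <= size q.
  have [/existsP[u /existsP[v /eqP dE]]|no] :=
      boolP [exists u : Q3 n, exists v : Q3 n, d == [set u; v]].
    have [p pP] := short (lex u) (lex v); exists p => u' v' dE'.
    have jE q : joins (lex u') (lex v') q = joins (lex u) (lex v) q.
      case: q => //= z s; congr [&& _, _ & _ == _].
      by rewrite -!imset_set1 -!imsetU -dE -dE'.
    by rewrite jE; case: pP => jp mp; split=> // q; rewrite jE; exact: mp.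
  exists [::] => u v dE; case/existsP: no; exists u.
  by apply/existsP; exists v; rewrite dE.
have rt_joins (u v : Q3 n) : adj u v -> joins (lex u) (lex v) (rt [set u; v]).
  by move=> _; case: (rtP _ u v erefl).
exists (Embedding (lex_bij n_gt0) rt_joins); split=> // u v _.
by case: (rtP _ u v erefl).
Qed.

(* Main.v *)
Require Import Defs.
From mathcomp Require Import all_boot zify.

Set Implicit Arguments.
Unset Strict Implicit.
Unset Printing Implicit Defensive.

(** The distance between (a, r) and (a', r') in the cylinder is [a <> a'] plus
    |r - r'|, so the least wirelength of a bijection is the sum of the edge
    boundaries, in the ternary cube, of the preimages of the sets "rows <= t",
    plus half the sum of those of the preimages of the three columns.  It is
    enough to minimise every boundary separately.  The ternary cube being
    regular, this is Lindsey's edge-isoperimetric theorem: k vertices span at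
    most digit_total k edges, the sum of the ternary digit sums of the integers
    below k, with equality for the k smallest labels.  Under lex the row sets
    are such initial segments, and the columns are subcubes of dimension
    n - 1, which are optimal too. *)

(** * Ternary digit sums *)

(** As [m < 3 ^ m], every nonzero ternary digit of [m] sits at a position below [m]. *)
Definition digit_sum (m : nat) : nat := \sum_(i < m) (m %/ 3 ^ i) %% 3.

Lemma digit_sum_widen m k : m <= k ->
  digit_sum m = \sum_(i < k) (m %/ 3 ^ i) %% 3.
Proof.
move=> le_mk; rewrite /digit_sum (big_ord_widen _ (fun i => m %/ 3 ^ i %% 3) le_mk).
rewrite [RHS](bigID (fun i : 'I_k => i < m)) /= [X in _ + X]big1 ?addn0 // => i.
rewrite -leqNgt => le_mi; rewrite divn_small // (leq_ltn_trans le_mi) //.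
exact: ltn_expl.
Qed.

Lemma digit_sum_rec q r : r < 3 -> digit_sum (3 * q + r) = digit_sum q + r.
Proof.
move=> r3; rewrite (@digit_sum_widen _ (3 * q + r).+1) // big_ord_recl /=.
rewrite divn1 mulnC modnMDl modn_small // addnC; congr (_ + _).
rewrite (@digit_sum_widen q (q * 3 + r)); last by lia.
apply: eq_bigr => i _; rewrite /bump /= add1n expnS divnMA divnMDl //.
by rewrite [r %/ 3]divn_small // addn0.
Qed.

Definition digit_total (k : nat) : nat := \sum_(j < k) digit_sum j.

Lemma digit_totalS k : digit_total k.+1 = digit_total k + digit_sum k.
Proof. by rewrite /digit_total big_ord_recr. Qed.

(** Sort the integers below [3 * q] by last digit: each class contributes [digit_total q], and the
    last digits add [0 + 1 + 2] for each quotient. In the next two lemmas one or two classes have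
    [q.+1] members. *)
Lemma digit_total_mul3 q : digit_total (3 * q) = 3 * digit_total q + 3 * q.
Proof.
elim: q => [|q IHq]; first by rewrite muln0 /digit_total big_ord0.
have -> : 3 * q.+1 = (3 * q).+3 by lia.
rewrite !digit_totalS IHq.
have := @digit_sum_rec q 0 isT; have := @digit_sum_rec q 1 isT.
have := @digit_sum_rec q 2 isT; rewrite addn0 addn1 addn2; lia.
Qed.

Lemma digit_total_mul3D1 q :
  digit_total (3 * q).+1 = 2 * digit_total q + digit_total q.+1 + 3 * q.
Proof.
rewrite !digit_totalS digit_total_mul3.
by have := @digit_sum_rec q 0 isT; rewrite addn0; lia.
Qed.

Lemma digit_total_mul3D2 q :
  digit_total (3 * q).+2 = digit_total q + 2 * digit_total q.+1 + (3 * q).+1.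
Proof.
rewrite digit_totalS digit_total_mul3D1 digit_totalS.
by have := @digit_sum_rec q 1 isT; rewrite addn1; lia.
Qed.

Lemma digit_total_exp3 k : digit_total (3 ^ k) = k * 3 ^ k.
Proof.
elim: k => [|k IHk]; last by rewrite expnS digit_total_mul3 IHk; lia.
by rewrite /digit_total big_ord1 /digit_sum big_ord0.
Qed.

(** * Superadditivity of the digit totals *)

Definition balanced (p q r : nat) : bool :=
  [&& p <= q.+1, p <= r.+1, q <= p.+1, q <= r.+1, r <= p.+1 & r <= q.+1].

Lemma balancedD x p q r : balanced (x + p) (x + q) (x + r) = balanced p q r.
Proof. by rewrite /balanced -!addnS !leq_add2l. Qed.

(** Bounds the edges between three parallel slices of sizes [a], [b], [c]: the edges between two
    slices form a matching. *)
Definition pair_mins (a b c : nat) : nat := minn a b + minn a c + minn b c.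

Lemma pair_minsD x p q r :
  pair_mins (x + p) (x + q) (x + r) = 3 * x + pair_mins p q r.
Proof. by rewrite /pair_mins -!addn_minr; lia. Qed.

(** The equality case of superadditivity: the parts are [m] or [m.+1], so the total is [3 * m],
    [3 * m + 1] or [3 * m + 2], and the formulas above apply. *)
Lemma digit_total_balanced p q r : balanced p q r ->
  digit_total (p + q + r) =
    digit_total p + digit_total q + digit_total r + pair_mins p q r.
Proof.
rewrite /balanced => bal.
have [m [pE qE rE nE]] : exists m, [/\ p = m \/ p = m.+1, q = m \/ q = m.+1,
    r = m \/ r = m.+1 & [|| p == m, q == m | r == m]].
  by exists (minn p (minn q r)); split; lia.
have E0 := digit_total_mul3 m; have E1 := digit_total_mul3D1 m.
have E2 := digit_total_mul3D2 m.
have Em : m + m + m = 3 * m by lia.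
rewrite /pair_mins.
case: pE nE {bal} => ->; case: qE => ->; case: rE => -> => nE;
  rewrite ?addSn ?addnS ?addSn Em; lia.
Qed.

(** If [x = y], both sides agree. Otherwise the smaller quotient decides every minimum that contains
    [x] and [y], and what remains is that a sum of minima is at most the minimum of the sums. *)
Lemma minn_mul3D x y i j (p q : nat -> nat) :
  (forall t, p t <= 1) -> (forall t, q t <= 1) ->
  i = p 0 + p 1 + p 2 -> j = q 0 + q 1 + q 2 ->
  minn (3 * x + i) (3 * y + j)
    + (minn (p 0) (q 0) + minn (p 1) (q 1) + minn (p 2) (q 2))
    <= minn (x + p 0) (y + q 0) + minn (x + p 1) (y + q 1)
       + minn (x + p 2) (y + q 2) + minn i j.
Proof.
move=> p1 q1; move: (p1 0) (p1 1) (p1 2) (q1 0) (q1 1) (q1 2).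
move: (p 0) (p 1) (p 2) (q 0) (q 1) (q 2) => p0 {}p1 p2 q0 {}q1 q2 *.
have [lt_xy|lt_yx|->] := ltngtP x y; last by rewrite -!addn_minr; lia.
  have minE u v : u <= 1 -> minn (x + u) (y + v) = x + u by move=> ?; lia.
  by rewrite !minE //; have -> : minn (3 * x + i) (3 * y + j) = 3 * x + i; lia.
have minE u v : v <= 1 -> minn (x + u) (y + v) = y + v by move=> ?; lia.
by rewrite !minE //; have -> : minn (3 * x + i) (3 * y + j) = 3 * y + j; lia.
Qed.

(* The remainders of a, b and c mod 3 are dealt out in turn to three bins, so that
   the bins stay balanced. *)
Lemma balanced_parts a b c : exists a0 a1 a2 b0 b1 b2 c0 c1 c2,
  [/\ a = a0 + a1 + a2, b = b0 + b1 + b2 & c = c0 + c1 + c2] /\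
  [/\ balanced a0 a1 a2, balanced b0 b1 b2, balanced c0 c1 c2 &
      balanced (a0 + b0 + c0) (a1 + b1 + c1) (a2 + b2 + c2)] /\
  pair_mins a0 a1 a2 + pair_mins b0 b1 b2 + pair_mins c0 c1 c2 + pair_mins a b c
    <= pair_mins a0 b0 c0 + pair_mins a1 b1 c1 + pair_mins a2 b2 c2
       + pair_mins (a0 + b0 + c0) (a1 + b1 + c1) (a2 + b2 + c2).
Proof.
have div3 x : exists y i, i < 3 /\ x = 3 * y + i by exists (x %/ 3), (x %% 3); lia.
have [a' [i [i3 ->]]] := div3 a; have [b' [j [j3 ->]]] := div3 b.
have [c' [l [l3 ->]]] := div3 c.
(* Leftovers of [a] fill bins from 0, those of [b] from bin [i], those of [c] from bin [i + j],
   cyclically. The added 3 and 6 keep the subtractions from truncating. *)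
pose pa t : nat := t < i.
pose pb t : nat := (t + 3 - i) %% 3 < j.
pose pc t : nat := (t + 6 - i - j) %% 3 < l.
have iE : i = pa 0 + pa 1 + pa 2 by case: i i3 @pa {pb pc} => [|[|[|]]].
have jE : j = pb 0 + pb 1 + pb 2.
  by case: i i3 {iE} @pa @pb {pc} => [|[|[|]]] //; case: j j3 => [|[|[|]]].
have lE : l = pc 0 + pc 1 + pc 2.
  case: i i3 {iE} @pa @pb @pc {jE} => [|[|[|]]] //; case: j j3 => [|[|[|]]] //;
    by case: l l3 => [|[|[|]]].
(* The claim for the remainders alone is 27 cases of computation; [minn_mul3D] then brings in the
   quotients. *)
have bits : [/\ balanced (pa 0) (pa 1) (pa 2), balanced (pb 0) (pb 1) (pb 2),
    balanced (pc 0) (pc 1) (pc 2) & balanced (pa 0 + pb 0 + pc 0)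
    (pa 1 + pb 1 + pc 1) (pa 2 + pb 2 + pc 2)] /\
  pair_mins (pa 0) (pa 1) (pa 2) + pair_mins (pb 0) (pb 1) (pb 2)
    + pair_mins (pc 0) (pc 1) (pc 2) + pair_mins i j l
  <= pair_mins (pa 0) (pb 0) (pc 0) + pair_mins (pa 1) (pb 1) (pc 1)
    + pair_mins (pa 2) (pb 2) (pc 2)
    + pair_mins (pa 0 + pb 0 + pc 0) (pa 1 + pb 1 + pc 1) (pa 2 + pb 2 + pc 2).
  case: i i3 {iE} @pa @pb @pc {jE lE} => [|[|[|]]] //; case: j j3 => [|[|[|]]] //;
    by case: l l3 => [|[|[|]]].
have pa1 t : pa t <= 1 by apply: leq_b1.
have pb1 t : pb t <= 1 by apply: leq_b1.
have pc1 t : pc t <= 1 by apply: leq_b1.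
have Hab := minn_mul3D a' b' pa1 pb1 iE jE.
have Hac := minn_mul3D a' c' pa1 pc1 iE lE.
have Hbc := minn_mul3D b' c' pb1 pc1 jE lE.
exists (a' + pa 0), (a' + pa 1), (a' + pa 2).
exists (b' + pb 0), (b' + pb 1), (b' + pb 2).
exists (c' + pc 0), (c' + pc 1), (c' + pc 2).
have NE t : a' + pa t + (b' + pb t) + (c' + pc t) =
  a' + b' + c' + (pa t + pb t + pc t) by lia.
clearbody pa pb pc; rewrite !NE !balancedD !pair_minsD.
case: bits => bal le_m; split.
  by split; rewrite (iE, jE, lE); clear; lia.
split=> //; clear -le_m Hab Hac Hbc; move: le_m Hab Hac Hbc; rewrite /pair_mins.
do ![move: (minn _ _) => ?]; lia.
Qed.

(** Strong induction on the total. Each argument is cut into three parts, regrouped into three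
    smaller triples. Cutting the arguments and the total is balanced, hence exact, and the
    inequality of [balanced_parts] absorbs the rest. *)
Lemma digit_total_superadd a b c :
  digit_total a + digit_total b + digit_total c + pair_mins a b c
    <= digit_total (a + b + c).
Proof.
have [N] := ubnP (a + b + c); elim: N a b c => // N IHN a b c leN.
(* A total of at least 2 cannot stay in one bin of a balanced split, so the triples do get smaller;
   below that, two of the arguments vanish. *)
have [small|big] := leqP (a + b + c) 1.
  have E : [|| (a == 0) && (b == 0), (a == 0) && (c == 0) | (b == 0) && (c == 0)].
    by lia.
  have F0 : digit_total 0 = 0 by rewrite /digit_total big_ord0.
  rewrite /pair_mins.
  by case/or3P: E => /andP[/eqP-> /eqP->]; rewrite ?minn0 ?min0n ?F0 ?addn0 ?add0n.
have [a0 [a1 [a2 [b0 [b1 [b2 [c0 [c1 [c2]]]]]]]]] := balanced_parts a b c.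
case=> -[aE bE cE] [[bala balb balc balN] le_m].
have [lt0 lt1 lt2] : [/\ a0 + b0 + c0 < N, a1 + b1 + c1 < N & a2 + b2 + c2 < N].
  by move: balN; rewrite /balanced => balN; split; lia.
have H0 := IHN a0 b0 c0 lt0; have H1 := IHN a1 b1 c1 lt1.
have H2 := IHN a2 b2 c2 lt2.
have -> : a + b + c = a0 + b0 + c0 + (a1 + b1 + c1) + (a2 + b2 + c2) by lia.
rewrite (digit_total_balanced balN).
have := digit_total_balanced bala; have := digit_total_balanced balb.
have := digit_total_balanced balc; rewrite -aE -bE -cE; lia.
Qed.

(** * Edge isoperimetry in the ternary cube *)

(** Modulo 3 any two distinct residues differ by 1 up to sign, so adjacency is Hamming distance
    one. *)
Lemma qadjP n (x y : Q3 n) :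
  reflect (exists2 j, x j != y j & forall i, i != j -> x i = y i) (adj x y).
Proof.
have neqE (a b : 'I_3) : (a == b + 1 %[mod 3]) || (a + 1 == b %[mod 3]) = (a != b).
  by case: a => -[|[|[|//]]] ?; case: b => -[|[|[|//]]] ?.
apply: (iffP existsP) => -[j].
  rewrite neqE => /andP[xyj /forallP xyi]; exists j => // i ij.
  by apply/eqP; apply: (implyP (xyi i)).
move=> xyj xyi; exists j; rewrite neqE xyj; apply/forallP => i.
by apply/implyP => /xyi->.
Qed.

Definition upd n (x : Q3 n) (j : 'I_n) (v : 'I_3) : Q3 n :=
  [ffun i => if i == j then v else x i].

Lemma updE n (x : Q3 n) j v i : upd x j v i = if i == j then v else x i.
Proof. by rewrite ffunE. Qed.

Lemma sum_adj_upd n (x : Q3 n) (F : Q3 n -> nat) :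
  \sum_(y | adj x y) F y = \sum_j \sum_(v | v != x j) F (upd x j v).
Proof.
pose h (p : 'I_n * 'I_3) := upd x p.1 p.2.
pose A := [set p : 'I_n * 'I_3 | p.2 != x p.1].
rewrite (eq_bigl (mem (h @: A))) => [|y]; last first.
  apply/qadjP/imsetP => [[j xyj xyi]|[[j v]]].
    exists (j, y j); first by rewrite inE eq_sym.
    by apply/ffunP => i; rewrite updE /=; have [->|/xyi->] := eqVneq i j.
  rewrite inE /= => vx ->; exists j; rewrite ?updE ?eqxx 1?eq_sym //.
  by move=> i ij; rewrite updE (negPf ij).
rewrite big_imset /=; last first.
  move=> [j v] [k w]; rewrite !inE /= => vj wk E.
  have := congr1 (fun y : Q3 n => y j) E; rewrite !updE /= eqxx.
  have [-> ->//|_ vx] := eqVneq j k; by rewrite vx eqxx in vj.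
rewrite (pair_big_dep xpredT (fun j v => v != x j)) /=.
by apply: eq_bigl => p; rewrite inE.
Qed.

Lemma card_adj n (x : Q3 n) : \sum_(y : Q3 n) adj x y = 2 * n.
Proof.
rewrite -big_mkcond sum_adj_upd.
rewrite (eq_bigr (fun=> 2)) => [|j _]; first by rewrite sum_nat_const card_ord mulnC.
by rewrite sum1_card cardC1 card_ord.
Qed.

(** Ordered pairs are counted: an edge inside [A] counts twice in [edge_count A A], an edge of the
    cut between [A] and its complement once. *)
Definition edge_count (G : sgraph) (A B : {set G}) : nat :=
  \sum_(x in A) \sum_(y in B) adj x y.

Lemma edge_count_sym (G : sgraph) (A B : {set G}) : edge_count A B = edge_count B A.
Proof.
rewrite /edge_count exchange_big; apply: eq_bigr => x _.
by apply: eq_bigr => y _; rewrite adj_sym.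
Qed.

(** Regularity of degree [2 * n]: for a fixed size, a small boundary means many inner edges. *)
Lemma edge_count_boundary n (S : {set Q3 n}) :
  edge_count S (~: S) + edge_count S S = 2 * n * #|S|.
Proof.
rewrite /edge_count -big_split /= mulnC -sum_nat_const; apply: eq_bigr => x _.
rewrite -(card_adj x) [RHS](bigID (mem S)) /= addnC; congr (_ + _).
by apply: eq_bigl => y; rewrite inE.
Qed.

Lemma edge_count_split (G : sgraph) (I : finType) (c : G -> I) (S : {set G}) :
  edge_count S S =
    \sum_a \sum_b edge_count [set x in S | c x == a] [set x in S | c x == b].
Proof.
rewrite /edge_count (partition_big c xpredT) //=; apply: eq_bigr => a _.
rewrite [RHS]exchange_big /=; apply: eq_big => [x|x _]; first by rewrite inE.
rewrite (partition_big c xpredT) //=; apply: eq_bigr => b _.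
by apply: eq_bigl => y; rewrite inE.
Qed.

(** An edge between the slices changes coordinate [j] only, so [upd x j b] is the sole possible
    neighbour of [x] in [B]. *)
Lemma edge_count_slices n (j : 'I_n) (a b : 'I_3) (A B : {set Q3 n}) : a != b ->
  {in A, forall x : Q3 n, x j = a} -> {in B, forall x : Q3 n, x j = b} ->
  edge_count A B <= #|A|.
Proof.
move=> ab Aa Bb; rewrite -sum1_card; apply: leq_sum => x xA.
rewrite -(cards1 (upd x j b)) -sum1_card.
rewrite [leqLHS]big_mkcond [leqRHS]big_mkcond; apply: leq_sum => y _.
case: ifP => // yB; rewrite inE; case: qadjP => //= -[k xyk xyi].
have jk : j = k.
  by apply/eqP; apply: contraNT ab => /xyi; rewrite (Aa x) // (Bb y) // => ->.
rewrite ifT //; apply/eqP/ffunP => i; rewrite updE -(Bb y yB).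
by have [->//|] := eqVneq i j; rewrite {1}jk => /xyi.
Qed.

(* Lindsey's theorem, by induction on the number of coordinates on which the
   points of S are allowed to differ. *)
Lemma edge_isoperimetry n (S : {set Q3 n}) :
  edge_count S S <= 2 * digit_total #|S|.
Proof.
suff main k : k <= n -> forall S : {set Q3 n},
    {in S &, forall (x y : Q3 n) (i : 'I_n), k <= i -> x i = y i} ->
    edge_count S S <= 2 * digit_total #|S|.
  by apply: (main n) => // x y _ _ i; rewrite leqNgt ltn_ord.
elim: k {S} => [|k IHk] lekn S agree.
  rewrite /edge_count big1 // => x xS; rewrite big1 // => y yS.
  by rewrite (_ : x = y) ?adj_irr //; apply/ffunP => i; apply: agree.
pose j := Ordinal lekn; pose T a := [set x in S | (x : Q3 n) j == a].
have TE a : edge_count (T a) (T a) <= 2 * digit_total #|T a|.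
  apply: IHk => [|x y]; first exact: ltnW.
  rewrite !inE => /andP[xS /eqP xa] /andP[yS /eqP ya] i.
  rewrite leq_eqVlt => /predU1P[ik|]; last exact: agree.
  by rewrite (_ : i = j) ?xa ?ya //; apply: val_inj.
have TX a b : a != b -> edge_count (T a) (T b) <= minn #|T a| #|T b|.
  have Tj c : {in T c, forall x : Q3 n, x j = c}.
    by move=> x; rewrite inE => /andP[_ /eqP].
  move=> ab; rewrite leq_min (edge_count_slices ab (Tj a) (Tj b)) edge_count_sym.
  by rewrite eq_sym in ab; rewrite (edge_count_slices ab (Tj b) (Tj a)).
have cardS : #|S| = \sum_a #|T a|.
  rewrite -sum1_card (partition_big (fun x : Q3 n => x j) xpredT) //=.
  by apply: eq_bigr => a _; rewrite -sum1_card; apply: eq_bigl => x; rewrite inE.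
have -> : edge_count S S = \sum_a \sum_b edge_count (T a) (T b).
  exact: edge_count_split.
rewrite cardS !big_ord_recl !big_ord0.
set t0 : 'I_3 := ord0; set t1 : 'I_3 := lift ord0 ord0.
set t2 : 'I_3 := lift ord0 (lift ord0 ord0).
(* Edges inside the slices give the three digit totals, edges across them at most [pair_mins];
   superadditivity combines both. *)
have := digit_total_superadd #|T t0| #|T t1| #|T t2|; rewrite /pair_mins.
have := TE t0; have := TE t1; have := TE t2.
have := TX t0 t1 isT; have := TX t0 t2 isT; have := TX t1 t2 isT.
rewrite (edge_count_sym (T t1) (T t0)) (edge_count_sym (T t2) (T t0)).
rewrite (edge_count_sym (T t2) (T t1)).
rewrite !addn0 !addnA.
do 3![move: (minn _ _) => ?].
lia.
Qed.

(** * Initial segments of the label order *)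

Lemma label_lt n (x : Q3 n) : label x < 3 ^ n.
Proof.
case: n x => [|n] x; first by rewrite /label big_ord0.
by have := label_row x; rewrite /= expnS; lia.
Qed.

Lemma digit_sum_label n (x : 'I_n -> 'I_3) : digit_sum (label x) = \sum_i x i.
Proof.
elim: n x => [|n IHn] x; first by rewrite /label !big_ord0 /digit_sum big_ord0.
by rewrite labelS mulnC digit_sum_rec // IHn big_ord_recl addnC.
Qed.

Lemma label_upd n (x : Q3 n) j v :
  label (upd x j v) + x j * 3 ^ j = label x + v * 3 ^ j.
Proof.
rewrite /label (bigD1 j) //= [X in _ = X + _](bigD1 j) //= updE eqxx.
rewrite (eq_bigr (fun i : 'I_n => x i * 3 ^ i)) => [|i ij].
  by rewrite addnAC [RHS]addnAC [_ + v * _]addnC.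
by rewrite updE (negPf ij).
Qed.

(** In direction [j] the label decreases for exactly the [x j] values below [x j], and these
    coordinates are the digits of the label. *)
Lemma lower_neighbours n (x : Q3 n) :
  \sum_(y | adj x y) (label y < label x) = digit_sum (label x).
Proof.
rewrite sum_adj_upd digit_sum_label; apply: eq_bigr => j _.
have lt_upd v : (label (upd x j v) < label x) = (v < x j).
  rewrite -(ltn_add2r (x j * 3 ^ j)) label_upd ltn_add2l ltn_pmul2r //.
  by rewrite expn_gt0.
under eq_bigr do rewrite lt_upd.
rewrite big_mkcond /= !big_ord_recl big_ord0.
by case: (x j) => -[|[|[|]]].
Qed.

Definition initial n k : {set Q3 n} := [set x : Q3 n | label x < k].

Lemma label_sum n k (F : nat -> nat) : k <= 3 ^ n ->
  \sum_(x in initial n k) F (label (x : Q3 n)) = \sum_(j < k) F j.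
Proof.
move=> lek; pose h (x : Q3 n) := Ordinal (label_lt x).
have h_bij : bijective h.
  apply: inj_card_bij => [x y /(congr1 val)/label_inj E|]; first exact/ffunP.
  by rewrite card_ffun !card_ord.
rewrite (big_ord_widen _ F lek) (reindex h) /=; last exact: onW_bij.
by apply: eq_bigl => x; rewrite inE.
Qed.

Lemma card_initial n k : k <= 3 ^ n -> #|initial n k| = k.
Proof.
by move=> lek; rewrite -sum1_card (label_sum (fun=> 1) lek) sum_nat_const card_ord muln1.
Qed.

(** Charge each edge to its end of larger label. An initial segment contains all lower neighbours of
    its points, so a point is charged its digit sum. *)
Lemma edge_count_initial n k : k <= 3 ^ n ->
  edge_count (initial n k) (initial n k) = 2 * digit_total k.
Proof.
move=> lek; rewrite /digit_total -(label_sum digit_sum lek).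
pose L (x y : Q3 n) : nat := adj x y && (label y < label x).
have LE : \sum_(x in initial n k) \sum_(y in initial n k) L x y =
    \sum_(x in initial n k) digit_sum (label (x : Q3 n)).
  apply: eq_bigr => x; rewrite inE => xk; rewrite -lower_neighbours.
  rewrite big_mkcond [RHS]big_mkcond; apply: eq_bigr => y _; rewrite inE /L.
  case: (adj x y) => /=; last by case: ifP.
  by case: ifP => // yk; case: ltnP => // yx; rewrite (ltn_trans yx xk) in yk.
have LS x y : L x y + L y x = adj x y.
  rewrite /L [adj y x]adj_sym; case Axy: (adj x y) => //.
  have [||/label_inj xy] //= := ltngtP (label x) (label y).
  by move: Axy; rewrite (_ : x = y) ?adj_irr //; apply/ffunP.
rewrite -LE mul2n -addnn [X in _ = _ + X]exchange_big -big_split /=.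
apply: eq_bigr => x _; rewrite -big_split /=.
by apply: eq_bigr => y _; rewrite LS.
Qed.

Lemma initial_boundary_min n (S : {set Q3 n}) :
  edge_count (initial n #|S|) (~: initial n #|S|) <= edge_count S (~: S).
Proof.
have leS : #|S| <= 3 ^ n by rewrite (leq_trans (max_card _)) //= card_ffun !card_ord.
have := edge_count_boundary S; have := edge_count_boundary (initial n #|S|).
have := edge_isoperimetry S; rewrite card_initial // edge_count_initial //; lia.
Qed.

(** The degree sum [2 * n.+1 * 3 ^ n] loses at most [2 * (n * 3 ^ n)] to inner edges. *)
Lemma subcube_boundary_min n (S : {set Q3 n.+1}) : #|S| = 3 ^ n ->
  2 * 3 ^ n <= edge_count S (~: S).
Proof.
move=> cardS; have := edge_count_boundary S; have := edge_isoperimetry S.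
rewrite cardS digit_total_exp3; lia.
Qed.

(** * Wirelength and distances in the cylinder *)

Lemma path_edges_head (H : sgraph) (z u : H) s d :
  u \notin z :: s -> d \in path_edges (z :: s) -> u \notin d.
Proof.
elim: s z => //= y s IHs z; rewrite inE negb_or => /andP[uz us].
rewrite inE => /predU1P[->|]; last exact: IHs.
by move: us; rewrite !inE !negb_or uz => /andP[].
Qed.

(** The first edge contains [z], which a simple path never revisits. Hence a route adds its exact
    length to the total congestion. *)
Lemma path_edges_uniq (H : sgraph) (z : H) s :
  uniq (z :: s) -> uniq (path_edges (z :: s)).
Proof.
elim: s z => //= y s IHs z /andP[zs us]; rewrite IHs // andbT.
by apply/negP => /(path_edges_head zs); rewrite !inE eqxx.
Qed.

Lemma path_edges_sub (H : sgraph) (z : H) s : path (@adj H) z s ->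
  {subset path_edges (z :: s) <= edges H}.
Proof.
elim: s z => //= y s IHs z /andP[zy ys] d; rewrite inE.
case/predU1P => [->|]; last exact: IHs.
by rewrite inE; apply/existsP; exists z; apply/existsP; exists y; rewrite zy eqxx.
Qed.

Lemma edgesP (G : sgraph) (d : {set G}) :
  reflect (exists x y, adj x y /\ d = [set x; y]) (d \in edges G).
Proof.
rewrite inE; apply: (iffP existsP) => -[x].
  by case/existsP => y /andP[xy /eqP->]; exists x, y.
by case=> y [xy ->]; exists x; apply/existsP; exists y; rewrite xy eqxx.
Qed.

(** Each edge arises from exactly two ordered pairs of adjacent vertices. *)
Lemma sum_edges2 (G : sgraph) (F : {set G} -> nat) :
  2 * \sum_(d in edges G) F d = \sum_(x : G) \sum_(y | adj x y) F [set x; y].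
Proof.
rewrite pair_big_dep /=.
rewrite (partition_big (fun p : G * G => [set p.1; p.2]) (mem (edges G))) /=; last first.
  by move=> [x y] /= xy; apply/edgesP; exists x, y.
rewrite big_distrr /=; apply: eq_bigr => d /edgesP[x [y [xy dE]]].
have xNy : x != y by apply: contraTneq xy => ->; rewrite adj_irr.
rewrite (eq_bigr (fun=> F d)) => [|p /andP[_ /eqP->] //].
rewrite sum_nat_const (_ : #|_| = 2) //.
rewrite (eq_card (B := [set (x, y); (y, x)])) ?cards2 ?xpair_eqE ?(negPf xNy) //.
move=> [u v]; rewrite !inE !xpair_eqE /= dE; apply/andP/orP => [[uv /eqP E]|].
  have uNv : u != v by apply: contraTneq uv => ->; rewrite adj_irr.
  have : u \in [set x; y] by rewrite -E !inE eqxx.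
  have : v \in [set x; y] by rewrite -E !inE eqxx orbT.
  rewrite !inE => /pred2P[] vE /pred2P[] uE; rewrite uE vE ?eqxx // in uNv *.
    by right.
  by left.
by case=> /andP[/eqP-> /eqP->]; split; rewrite // 1?adj_sym // setUC.
Qed.

(** Double counting: exchanging the sums over host and guest edges turns total congestion into total
    route length, one less than the number of vertices. *)
Lemma wirelengthE (G H : sgraph) (f : embedding G H) :
  2 * wirelength f =
    \sum_(x : G) \sum_(y | adj x y) (size (route f [set x; y])).-1.
Proof.
rewrite -(sum_edges2 (fun d => (size (route f d)).-1)); congr (2 * _).
rewrite /wirelength; under eq_bigr => e _.
  rewrite /congestion -sum1_card; under eq_bigl do rewrite inE.
  rewrite big_mkcondr; over.
rewrite exchange_big /=; apply: eq_bigr => d /edgesP[x [y [xy ->]]].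
case: (route f _) (routeP f xy) => //= z s /and3P[zs us _].
rewrite -big_mkcondr sum1_card -(size_pairmap (fun u v => [set u; v]) z s).
rewrite -(card_uniqP (path_edges_uniq us)); apply: eq_card => e.
rewrite unfold_in /=; apply/andP/idP => [[]//|ezs]; split=> //.
exact: path_edges_sub zs _ ezs.
Qed.

(** Of the two truncated differences one is 0, so their sum is the absolute difference of the
    rows. *)
Definition cyl_dist m (p q : cylinder m) : nat :=
  (p.1 != q.1) + ((p.2 - q.2) + (q.2 - p.2)).

Lemma cyl_dist_path m (z : cylinder m) s : path (@adj (cylinder m)) z s ->
  cyl_dist z (last z s) <= size s.
Proof.
rewrite /cyl_dist.
elim: s z => [|y s IHs] z /=; first by rewrite eqxx; lia.
move=> /andP[zy /IHs]; move: (size s) (last y s) => k w {IHs s}.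
case: z y w zy => [a r] [b t] [c u]; rewrite /cyl_adj /=.
case/orP=> /andP[]; first by move=> _ /eqP->; case: (_ != _); case: (_ != _); lia.
by move=> /eqP->; case: (_ != _); lia.
Qed.

Lemma cyl_dist_sym m (p q : cylinder m) : cyl_dist p q = cyl_dist q p.
Proof. by rewrite /cyl_dist eq_sym [X in _ + X]addnC. Qed.

Lemma joins_cyl_dist m (p q : cylinder m) s : joins p q s ->
  cyl_dist p q <= (size s).-1.
Proof.
case: s => //= z s /and3P[/cyl_dist_path le_d _ /eqP E].
suff -> : cyl_dist p q = cyl_dist z (last z s) by [].
have : p \in [set z; last z s] by rewrite E !inE eqxx.
have : q \in [set z; last z s] by rewrite E !inE eqxx orbT.
have : z \in [set p; q] by rewrite -E !inE eqxx.
have : last z s \in [set p; q] by rewrite -E !inE eqxx orbT.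
rewrite !inE => /pred2P[] lE /pred2P[] zE; rewrite lE zE ?orbb //.
- by move=> /eqP->.
- by move=> _ _; apply: cyl_dist_sym.
by move=> _ /eqP->.
Qed.

(** From [p != q] some neighbour is one closer to [q]: change column if necessary, else move one
    row. The walk so obtained is then shortened to a simple path. *)
Lemma cyl_dist_joins m (p q : cylinder m) :
  exists2 s, joins p q s & (size s).-1 <= cyl_dist p q.
Proof.
suff [s ps [-> les]] : exists2 s, path (@adj (cylinder m)) p s &
    q = last p s /\ size s <= cyl_dist p q.
  case/shortenP: ps les => s' ps' us' /uniq_leq_size sub les.
  exists (p :: s') => /=; first by rewrite ps' eqxx andbT.
  rewrite (leq_trans _ les) // sub //; by case/andP: us'.
have [k] := ubnP (cyl_dist p q); elim: k p => // k IHk p lek.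
have [->|pNq] := eqVneq p q; first by exists [::].
suff [z pz zq] : exists2 z : cylinder m, adj p z & (cyl_dist z q).+1 = cyl_dist p q.
  have [|s zs [qE les]] := IHk z; first by rewrite -ltnS zq.
  exists (z :: s); first by apply/andP; split.
  by split=> //; rewrite -zq ltnS.
case: p q pNq {k IHk lek} => [a r] [b s] /=; rewrite xpair_eqE negb_and /= => pNq.
have [ab|aNb] := eqVneq a b; last first.
  by exists (b, r); rewrite /= /cyl_adj /cyl_dist /= ?aNb ?eqxx //=; lia.
rewrite {}ab eqxx /= in pNq *.
have [lt_rs|lt_sr|/val_inj E] := ltngtP r s; last by rewrite E eqxx in pNq.
  have ltm : r.+1 < m by apply: leq_ltn_trans lt_rs (ltn_ord s).
  by exists (b, Ordinal ltm); rewrite /= /cyl_adj /cyl_dist /= ?eqxx ?orbT //=; lia.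
have ltm : r.-1 < m by have := ltn_ord r; lia.
by exists (b, Ordinal ltm); rewrite /= /cyl_adj /cyl_dist /= ?eqxx ?orbT //=; lia.
Qed.

(** * Cuts of the cylinder *)

Lemma edge_countE (G : sgraph) (A B : {set G}) :
  edge_count A B = \sum_x \sum_(y | adj x y) ((x \in A) && (y \in B)).
Proof.
rewrite /edge_count big_mkcond; apply: eq_bigr => x _.
case: (x \in A); last by rewrite big1.
by rewrite big_mkcond [RHS]big_mkcond; apply: eq_bigr => y _; do !case: ifP.
Qed.

Lemma sum_edge_count (G : sgraph) (I : finType) (A B : I -> {set G}) :
  \sum_i edge_count (A i) (B i) =
    \sum_x \sum_(y | adj x y) \sum_i ((x \in A i) && (y \in B i)).
Proof.
rewrite (eq_bigr _ (fun i _ => edge_countE (A i) (B i))) exchange_big.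
by apply: eq_bigr => x _; rewrite exchange_big.
Qed.

Lemma sum_between m r s : \sum_(t < m) (r <= t < s) = minn s m - r.
Proof.
elim: m => [|m IHm]; first by rewrite big_ord0 minn0.
by rewrite big_ord_recr /= IHm; lia.
Qed.

Definition column (G : sgraph) m (g : G -> cylinder m) (a : 'I_3) : {set G} :=
  [set x | (g x).1 == a].

Definition lower_rows (G : sgraph) m (g : G -> cylinder m) (t : 'I_m) : {set G} :=
  [set x | (g x).2 <= t].

(** Distance as a count of cuts: an ordered pair in different columns leaves exactly one column, and
    the row difference is the number of thresholds [t] separating the rows. *)
Lemma sum_cyl_dist (G : sgraph) m (g : G -> cylinder m) :
  \sum_x \sum_(y | adj x y) cyl_dist (g x) (g y) =
    \sum_a edge_count (column g a) (~: column g a)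
    + 2 * \sum_t edge_count (lower_rows g t) (~: lower_rows g t).
Proof.
rewrite mul2n -addnn.
(* One copy of the row cuts is reversed, to count the pairs that go down as the other counts those
   that go up. *)
rewrite -[X in _ + (_ + X)](eq_bigr _ (fun t _ =>
  edge_count_sym (~: lower_rows g t) (lower_rows g t))).
rewrite !sum_edge_count -!big_split /=; apply: eq_bigr => x _.
rewrite -!big_split /=; apply: eq_bigr => y _; rewrite /cyl_dist.
congr (_ + _).
  rewrite (bigD1 (g x).1) //= big1 => [|a aNx]; last by rewrite !inE eq_sym (negPf aNx).
  by rewrite !inE eqxx addn0 eq_sym.
rewrite addnC; congr (_ + _).
  rewrite -[in LHS](minn_idPl (ltnW (ltn_ord (g y).2))) -sum_between.
  by apply: eq_bigr => t _; rewrite !inE -ltnNge.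
rewrite -[in LHS](minn_idPl (ltnW (ltn_ord (g x).2))) -sum_between.
by apply: eq_bigr => t _; rewrite !inE -ltnNge andbC.
Qed.

Lemma card_preim_bij (S T : finType) (g : S -> T) (P : pred T) :
  bijective g -> #|[set x | P (g x)]| = #|[set y | P y]|.
Proof.
move=> g_bij; rewrite -!sum1_card [RHS](reindex g) /=; last exact: onW_bij.
by apply: eq_bigl => x; rewrite !inE.
Qed.

Lemma card_column (G : sgraph) m (g : G -> cylinder m) a :
  bijective g -> #|column g a| = m.
Proof.
move=> g_bij; rewrite /column (card_preim_bij (fun p : 'I_3 * 'I_m => p.1 == a)) //.
rewrite (_ : [set y | _] = setX [set a] setT); last first.
  by apply/setP => -[b r]; rewrite !inE andbT.
by rewrite cardsX cards1 cardsT card_ord mul1n.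
Qed.

Lemma card_lower_rows (G : sgraph) m (g : G -> cylinder m) (t : 'I_m) :
  bijective g -> #|lower_rows g t| = 3 * t.+1.
Proof.
move=> g_bij; rewrite /lower_rows (card_preim_bij (fun p : 'I_3 * 'I_m => p.2 <= t)) //.
rewrite (_ : [set y | _] = setX setT [set r : 'I_m | r <= t]); last first.
  by apply/setP => -[b r]; rewrite !inE.
rewrite cardsX cardsT card_ord -sum1dep_card -(big_ord_widen _ (fun=> 1) (ltn_ord t)).
by rewrite sum_nat_const card_ord muln1.
Qed.

Lemma lower_rows_lex n (t : 'I_(3 ^ n.-1)) :
  lower_rows (@lex n) t = initial n (3 * t.+1).
Proof.
by apply/setP => x; rewrite !inE /= mulnC -ltn_divLR.
Qed.

(** The column is the subcube where coordinate 0, the label modulo 3, equals [a]. Only the two moves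
    along that coordinate leave it. *)
Lemma column_lex_boundary n (a : 'I_3) :
  edge_count (column (@lex n.+1) a) (~: column (@lex n.+1) a) <= 2 * 3 ^ n.
Proof.
have cardA := card_column a (lex_bij (ltn0Sn n)).
rewrite -[leqRHS](congr1 (muln 2) cardA) mulnC -sum_nat_const.
apply: leq_sum => x xa.
have -> : \sum_(y in ~: column (@lex n.+1) a) adj x y =
    \sum_(y | adj x y) (y \notin column (@lex n.+1) a).
  rewrite big_mkcond [RHS]big_mkcond; apply: eq_bigr => y _.
  by rewrite inE; case: (y \in _); case: (adj x y).
rewrite sum_adj_upd (bigD1 ord0) //= [X in _ + X]big1 => [|j jN0]; last first.
  rewrite big1 // => v _; apply/eqP; rewrite eqb0 negbK.
  move: xa; rewrite !inE -!val_eqE /= !labelS !modnMDl.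
  by rewrite updE [ord0 == j]eq_sym (negPf jN0).
rewrite addn0 -[2]/(3.-1) -[in leqRHS](card_ord 3) -(cardC1 (x ord0)) -sum1_card.
by apply: leq_sum => v _; apply: leq_b1.
Qed.

Theorem theorem4p4 (n : nat) (hn : 2 <= n)
  (f : embedding (Q3 n) (cylinder (3 ^ n.-1)))
  (hlex : forall x : Q3 n, f x = lex x)
  (hshort : shortest_routed f) :
  is_min_wirelength (Q3 n) (cylinder (3 ^ n.-1)) (wirelength f).
Proof.
split=> [|g]; first by exists f.
rewrite -(leq_pmul2l (isT : 0 < 2)) !wirelengthE.
pose D (h : Q3 n -> cylinder (3 ^ n.-1)) :=
  \sum_x \sum_(y | adj x y) cyl_dist (h x) (h y).
have le_f : \sum_x \sum_(y | adj x y) (size (route f [set x; y])).-1 <= D (@lex n).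
  apply: leq_sum => x _; apply: leq_sum => y xy; rewrite -!hlex.
  have [q fq] := cyl_dist_joins (f x) (f y).
  by move/(leq_trans _); apply; have := hshort _ _ xy _ fq; clear; lia.
have le_g : D g <= \sum_x \sum_(y | adj x y) (size (route g [set x; y])).-1.
  apply: leq_sum => x _; apply: leq_sum => y xy.
  exact: joins_cyl_dist (routeP g xy).
(* The comparison is now cut by cut: a bijection fixes the size of each preimage, and [lex] attains
   the least boundary for each size. *)
apply: leq_trans le_f (leq_trans _ le_g); rewrite /D !sum_cyl_dist.
have g_bij := emb_bij g; apply: leq_add.
  apply: leq_sum => a _; case: n hn {f hlex hshort D le_g} g g_bij => // n _ g g_bij.
  exact: leq_trans (column_lex_boundary n a)
    (subcube_boundary_min (card_column a g_bij)).
rewrite leq_pmul2l //; apply: leq_sum => t _.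
by rewrite lower_rows_lex -(card_lower_rows t g_bij) initial_boundary_min.
Qed.
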